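(* Fix a variable $x_i$ and $d\ge1$. Let $V_0\subseteq Q_d$ and $V_1\subseteq Q_{d-1}$ be monomial vector spaces which are Gotzmann in $Q=R/(x_i)$ and satisfy $V_0=\mathbf n_1V_1$. Then $V=V_0\oplus x_iV_1\subseteq R_d$ is Gotzmann in $R$.
   Context: Let $\Bbbk$ be a field, $R=\Bbbk[x_1,\dots,x_n]/(x_1^2,\dots,x_n^2)$, $R_d$ its degree-$d$ component. A monomial vector space is a subspace of some $R_d$ spanned by monomials; $\mathbf m_1V$ is the span of $\{x_jm\}$ over monomials $m\in V$ and all $j$. A subspace $V\subseteq R_d$ is Gotzmann if $|\mathbf m_1V|\le|\mathbf m_1W|$ for every subspace $W\subseteq R_d$ with $|W|=|V|$ ($|\cdot|$ = dimension). $Q=R/(x_i)$ is the squarefree ring in the variables other than $x_i$, viewed as the subspace of $R$ spanned by monomials not divisible by $x_i$; $\mathbf n_1W$ is the span of $\{x_jm: j\neq i, m\in W\text{ monomial}\}$, and Gotzmann in $Q$ is defined analogously. *)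

(* Defs.v *)
From HB Require Import structures.
From mathcomp Require Import all_boot all_order all_algebra.
Set Implicit Arguments. Unset Strict Implicit. Unset Printing Implicit Defensive.
Import GRing.Theory.
Local Open Scope ring_scope.

(* The exterior-face ring R = k[x_1..x_n]/(x_1^2,..,x_n^2) as a k-vector space:
   an element is a function assigning a coefficient to each squarefree
   monomial, a squarefree monomial being identified with its support
   S : {set 'I_n}  (x_S = prod_{j in S} x_j, of degree #|S|). *)
Definition Rsq (k : fieldType) (n : nat) := {ffun {set 'I_n} -> k^o}.

Definition mono (k : fieldType) (n : nat) (S : {set 'I_n}) : Rsq k n :=
  [ffun T : {set 'I_n} => if T == S then 1 else 0].

(* multiplication by the variable x_j (x_j * x_T = x_{T+j} if j notin T, 0 otherwise) *)
Definition mulx_fun (k : fieldType) (n : nat) (j : 'I_n) (f : Rsq k n) : Rsq k n :=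
  [ffun U : {set 'I_n} => if j \in U then f (U :\ j) else 0].
Definition mulx (k : fieldType) (n : nat) (j : 'I_n) : 'End(Rsq k n) :=
  linfun (mulx_fun j).

Definition mspan (k : fieldType) (n : nat) (M : {set {set 'I_n}}) : {vspace Rsq k n} :=
  <<[seq mono k A | A <- enum M]>>%VS.

Definition monomial_space (k : fieldType) (n : nat) (V : {vspace Rsq k n}) : Prop :=
  exists M : {set {set 'I_n}}, V = mspan k M.

Definition Rdeg (k : fieldType) (n d : nat) : {vspace Rsq k n} :=
  mspan k [set A : {set 'I_n} | #|A| == d].

(* Q_d, Q = R/(x_i) viewed as span of monomials not divisible by x_i *)
Definition Qdeg (k : fieldType) (n : nat) (i : 'I_n) (d : nat) : {vspace Rsq k n} :=
  mspan k [set A : {set 'I_n} | (#|A| == d) && (i \notin A)].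

Definition m1 (k : fieldType) (n : nat) (W : {vspace Rsq k n}) : {vspace Rsq k n} :=
  (\sum_(j : 'I_n) (mulx k j @: W))%VS.

Definition n1 (k : fieldType) (n : nat) (i : 'I_n) (W : {vspace Rsq k n}) : {vspace Rsq k n} :=
  (\sum_(j : 'I_n | j != i) (mulx k j @: W))%VS.

Definition GotzmannR (k : fieldType) (n d : nat) (V : {vspace Rsq k n}) : Prop :=
  (V <= Rdeg k n d)%VS /\
  forall W : {vspace Rsq k n}, (W <= Rdeg k n d)%VS -> \dim W = \dim V ->
    (\dim (m1 V) <= \dim (m1 W))%N.

Definition GotzmannQ (k : fieldType) (n : nat) (i : 'I_n) (d : nat) (V : {vspace Rsq k n}) : Prop :=
  (V <= Qdeg k i d)%VS /\
  forall W : {vspace Rsq k n}, (W <= Qdeg k i d)%VS -> \dim W = \dim V ->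
    (\dim (n1 i V) <= \dim (n1 i W))%N.

(* Main.v *)
Require Import Defs.
From HB Require Import structures.
From mathcomp Require Import all_boot all_order all_algebra zify.
Set Implicit Arguments. Unset Strict Implicit. Unset Printing Implicit Defensive.
Import GRing.Theory.

(** The theorem is reduced to the Kruskal-Katona theorem for subspaces (not
    only monomial ones) of the squarefree ring.

    Let [S k m] be the cascade bound on the lower shadow of a family of [m]
    sets of size [k]; complementing supports, it bounds the dimension of the
    multiples by the variables of an [m]-dimensional space of forms of degree
    [r - k] in [r] variables.  For a variable [x] let [delta] be the derivation
    with [delta x + x delta = id].  A space [W] splits into the kernel [W0] of
    [delta] on [W] and the image [W1] of [W], and
    [dim m1 W >= dim n1 W0 + max (dim W0) (dim n1 W1)].  The lower bound for [W]
    then follows by induction on the number of variables from the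
    Eckhoff-Wegner inequality [S k.+1 (a+b) <= S k a + max a (S k.+1 b)].
    Cones over smaller optimal families show that the bound is attained, so
    Gotzmann spaces are exactly those meeting it.  Finally the Eckhoff-Wegner
    inequality is an equality when [a = S k.+1 b], which is the situation of
    [V0 = n1 V1]. *)

(** * The Kruskal-Katona function *)

(* The parameter [r], the size of the ground set, only makes the recursion
   structural: the value does not depend on it as long as [m <= 'C(r, k)]. *)
Fixpoint shadow_min (r k m : nat) : nat :=
  match r, k with
  | r'.+1, k'.+1 => if m <= 'C(r', k) then shadow_min r' k m
                    else 'C(r', k') + shadow_min r' k' (m - 'C(r', k))
  | _, _ => 0
  end.

(* Dual cascade: the largest number of [j.+1]-sets all of whose [j]-subsets lie
   in a family of [f] many [j]-sets. *)
Fixpoint ext_max (r j f : nat) : nat :=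
  match j, r with
  | 0, _ => if f == 0 then 0 else r
  | _, 0 => 0
  | j'.+1, r'.+1 => if f <= 'C(r', j) then ext_max r' j f
                    else 'C(r', j.+1) + ext_max r' j' (f - 'C(r', j))
  end.

Lemma shadow_min_k0 r m : shadow_min r 0 m = 0. Proof. by case: r. Qed.

Lemma shadow_min_m0 r k : shadow_min r k 0 = 0.
Proof. by elim: r k => [|r IH] [|k] //=. Qed.

Lemma shadow_min_small r k m : m <= 'C(r, k) -> shadow_min r.+1 k m = shadow_min r k m.
Proof. by case: k => [|k] H; rewrite ?shadow_min_k0 //= H. Qed.

Lemma shadow_min_big r k m x : m = 'C(r, k.+1) + x -> 0 < x ->
  shadow_min r.+1 k.+1 m = 'C(r, k) + shadow_min r k x.
Proof. by move=> -> Hx; rewrite /= addKn -[X in _ <= X]addn0 leq_add2l leqNgt Hx. Qed.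

Lemma shadow_min_widen r s k m : r <= s -> m <= 'C(r, k) -> shadow_min s k m = shadow_min r k m.
Proof.
move=> /subnK <-; elim: (s - r) => [|t IH] Hm //.
rewrite addSn shadow_min_small ?IH //.
by apply: leq_trans Hm _; apply: leq_bin2l; rewrite leq_addl.
Qed.

Lemma ext_max_m0 r j : ext_max r j 0 = 0.
Proof. by elim: r j => [|r IH] [|j] //=. Qed.

Lemma ext_max_j0 r m : ext_max r 0 m = if m == 0 then 0 else r.
Proof. by case: r. Qed.

Lemma ext_max_small r j m : m <= 'C(r, j.+1) -> ext_max r.+1 j.+1 m = ext_max r j.+1 m.
Proof. by move=> /= ->. Qed.

Lemma ext_max_big r j m x : m = 'C(r, j.+1) + x -> 0 < x ->
  ext_max r.+1 j.+1 m = 'C(r, j.+2) + ext_max r j x.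
Proof. by move=> -> Hx; rewrite /= addKn -[X in _ <= X]addn0 leq_add2l leqNgt Hx. Qed.

(** Both cascades branch at the same threshold ['C(r, k.+1)], the number of sets avoiding a chosen
    point, so one case analysis unfolds both. *)
Variant pascal_spec r k m : Type :=
| SplitSmall of m <= 'C(r, k.+1) & shadow_min r.+1 k.+1 m = shadow_min r k.+1 m
    & ext_max r.+1 k.+1 m = ext_max r k.+1 m
| SplitBig x of m = 'C(r, k.+1) + x & 0 < x & x <= 'C(r, k)
    & shadow_min r.+1 k.+1 m = 'C(r, k) + shadow_min r k x
    & ext_max r.+1 k.+1 m = 'C(r, k.+2) + ext_max r k x.

Lemma pascal_splitP r k m : m <= 'C(r.+1, k.+1) -> pascal_spec r k m.
Proof.
rewrite binS => H; case: (leqP m 'C(r, k.+1)) => Hm.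
  by apply: SplitSmall; rewrite ?shadow_min_small ?ext_max_small.
have E : m = 'C(r, k.+1) + (m - 'C(r, k.+1)) by lia.
by apply: (SplitBig E); rewrite -?(shadow_min_big E) -?(ext_max_big E) //; lia.
Qed.

Lemma shadow_min_full r k : k < r -> shadow_min r k.+1 'C(r, k.+1) = 'C(r, k).
Proof.
elim: r k => [|r IH] k // Hk.
have C0 : 0 < 'C(r, k) by rewrite bin_gt0 -ltnS.
rewrite (shadow_min_big (binS _ _)) //.
case: k => [|k] in Hk C0 *; first by rewrite shadow_min_k0 !bin0.
by rewrite IH // binS addnC.
Qed.

Lemma ext_max_full r j : ext_max r j 'C(r, j) = 'C(r, j.+1).
Proof.
elim: r j => [|r IH] [|j] //; first by rewrite bin0 bin1.
case: (ltnP r j) => Hj.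
  by rewrite bin_small ?ext_max_m0 ?bin_small //; lia.
rewrite (ext_max_big (binS _ _)) ?bin_gt0 //.
by rewrite IH binS.
Qed.

Lemma shadow_min_le r k m : m <= 'C(r, k.+1) -> shadow_min r k.+1 m <= 'C(r, k).
Proof.
elim: r k m => [|r IH] [|k] m // Hm; case: (pascal_splitP Hm) => [H E _|x E0 H H' E _].
- by rewrite E (leq_trans (IH _ _ H)) // leq_bin2l.
- by rewrite E shadow_min_k0 !bin0.
- by rewrite E (leq_trans (IH _ _ H)) // leq_bin2l.
- by rewrite E binS leq_add2l; apply: IH.
Qed.

Lemma shadow_min_mono r k a b : a <= b -> b <= 'C(r, k) -> shadow_min r k a <= shadow_min r k b.
Proof.
elim: r k a b => [|r IH] [|k] a b // Hab Hb.
have Ha := leq_trans Hab Hb.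
case: (pascal_splitP Ha) => [Ha1 -> _|x Ea Hx Hx' -> _];
  case: (pascal_splitP Hb) => [Hb1 -> _|y Eb Hy Hy' -> _]; try lia.
- exact: IH.
- by have := shadow_min_le Ha1; lia.
- by rewrite leq_add2l; apply: IH; lia.
Qed.

(** The only true dependence on the ground set is at [j = 0]: the empty set extends to every
    singleton. *)
Lemma ext_max_mono_r r s j m : r <= s -> m <= 'C(r, j) -> ext_max r j m <= ext_max s j m.
Proof.
move=> /subnK <-; elim: (s - r) => [|t IH] // Hm.
apply: leq_trans (IH Hm) _; rewrite addSn.
case: j => [|j] in Hm {IH} *; first by rewrite !ext_max_j0; case: eqP.
case: (leqP m 'C(t + r, j.+1)) => H; first by rewrite ext_max_small.
by have := leq_bin2l j.+1 (leq_addl t r); lia.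
Qed.

Lemma ext_max_le r j m : m <= 'C(r, j) -> ext_max r j m <= 'C(r, j.+1).
Proof.
elim: r j m => [|r IH] [|j] m // Hm.
- by move: Hm; rewrite bin0 bin1; case: m => [|[]].
- by move: Hm; rewrite bin0 bin1; case: m => [|[]].
case: (pascal_splitP Hm) => [H _ E|x E0 H H' _ E].
- by rewrite E (leq_trans (IH _ _ H)) // leq_bin2l.
- by rewrite E binS leq_add2l; apply: IH.
Qed.

(** * Complementation duality *)

Lemma bin_compl r a b : a + b = r -> 'C(r, a) = 'C(r, b).
Proof. by move=> <-; rewrite -[LHS]bin_sub ?leq_addr // addKn. Qed.

(** Numerical form of complementation. Given [f] many [j]-sets, the complements of the other
    [j]-sets are [k.+1]-sets; a [k]-set is outside their shadow exactly when all [j]-subsets of its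
    complement belong to the given family. *)
Lemma shadow_min_ext_max j k f : f <= 'C(j + k.+1, j) ->
  shadow_min (j + k.+1) k.+1 ('C(j + k.+1, j) - f) + ext_max (j + k.+1) j f = 'C(j + k.+1, k).
Proof.
move Er: (j + k.+1) => r; elim: r j k Er f => [|r IH] j k Er f; first by lia.
case: j Er => [|j] Er.
  have -> : r = k by lia.
  rewrite bin0; case: f => [|[|f]] // _.
    by rewrite subn0 ext_max_m0 addn0 -{1}(binn k.+1) shadow_min_full.
  by rewrite subnn shadow_min_m0 /= binSn.
have Es : 'C(r, j.+1) = 'C(r, k) by apply: bin_compl; lia.
have Es' : 'C(r, j) = 'C(r, k.+1) by apply: bin_compl; lia.
have Es2 : 0 < k -> 'C(r, j.+2) = 'C(r, k.-1).
  by move=> k0; apply: bin_compl; lia.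
have kr : k <= r by lia.
have Ck : 0 < 'C(r, k) by rewrite bin_gt0.
move=> Hf; case: (pascal_splitP Hf) => [H _ ->|x Ef H H' _ ->].
  rewrite binS Es Es' in Hf *; rewrite Es in H.
  (* The complementary count exceeds ['C(r, k.+1)] by ['C(r, k) - f]. When this excess is 0,
     [shadow_min] takes its small branch as well. *)
  case: (leqP 'C(r, k) f) => Hf2.
    have -> : f = 'C(r, k) by lia.
    rewrite addKn shadow_min_small // -Es ext_max_full.
    case: k => [|k] in Er IH Es Es' Es2 kr Ck H Hf2 Hf *.
      rewrite bin0 shadow_min_full ?bin0; last by lia.
      by rewrite bin_small //; lia.
    by rewrite Es2 // binS shadow_min_full //; lia.
  rewrite (shadow_min_big (x := 'C(r, k) - f)); [|lia|lia].
  case: k => [|k] in Er IH Es Es' Es2 kr Ck H Hf2 Hf *.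
    have -> : f = 0 by rewrite bin0 in Hf2; lia.
    by rewrite shadow_min_k0 ext_max_m0 !bin0.
  have Er' : j.+1 + k.+1 = r by lia.
  by have := IH _ _ Er' f; rewrite Es binS; lia.
rewrite Es in Ef; rewrite binS Es Es' Ef in Hf *.
have -> : 'C(r, k) + 'C(r, k.+1) - ('C(r, k) + x) = 'C(r, k.+1) - x by lia.
rewrite shadow_min_small; last by lia.
have Er' : j + k.+1 = r by lia.
have := IH _ _ Er' x; rewrite Es' => /(_ ltac:(lia)) E.
case: k => [|k] in E Er Er' IH Es Es' Es2 kr Ck H H' Hf Ef *.
  by rewrite !bin0 in E *; rewrite (@bin_small r j.+2); lia.
by rewrite Es2 // binS /=; lia.
Qed.

(** * Additivity of the two functions *)

Definition shadow_subadditive r :=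
  forall k a b, a + b <= 'C(r, k) -> shadow_min r k (a + b) <= shadow_min r k a + shadow_min r k b.

Definition ext_superadditive r :=
  forall j a b, a + b <= 'C(r, j) -> ext_max r j a + ext_max r j b <= ext_max r j (a + b).

(* Through [shadow_min_ext_max], each of the two additivity properties becomes, for the other
   function, a statement about overlapping families covering everything. *)
Lemma shadow_overlap r (superadd : ext_superadditive r)
   k a b : k < r -> a <= 'C(r, k.+1) -> b <= 'C(r, k.+1) -> 'C(r, k.+1) <= a + b ->
  'C(r, k) + shadow_min r k.+1 (a + b - 'C(r, k.+1)) <= shadow_min r k.+1 a + shadow_min r k.+1 b.
Proof.
move=> kr Ha Hb Hab.
have [j Ej] : exists j, r = j + k.+1 by exists (r - k.+1); lia.
have Es : 'C(r, j) = 'C(r, k.+1) by apply: bin_compl.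
have kE f : f <= 'C(r, j) -> shadow_min r k.+1 f + ext_max r j ('C(r, j) - f) = 'C(r, k).
  move=> Hf; rewrite -[in shadow_min _ _ f](subKn Hf).
  by rewrite Ej in Hf *; apply: shadow_min_ext_max; lia.
have := superadd j ('C(r, j) - a) ('C(r, j) - b).
have := kE a; have := kE b; have := kE (a + b - 'C(r, j)).
have -> : 'C(r, j) - (a + b - 'C(r, j)) = 'C(r, j) - a + ('C(r, j) - b) by lia.
by rewrite Es; lia.
Qed.

Lemma ext_overlap r (subadd : shadow_subadditive r)
   j a b : a <= 'C(r, j) -> b <= 'C(r, j) -> 'C(r, j) <= a + b ->
  ext_max r j a + ext_max r j b <= 'C(r, j.+1) + ext_max r j (a + b - 'C(r, j)).
Proof.
move=> Ha Hb Hab.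
case: (leqP r j) => jr.
  have := ext_max_le Ha; have := ext_max_le Hb.
  by rewrite bin_small; lia.
have [k Ek] : exists k, r = j + k.+1 by exists (r - j.+1); lia.
have Es : 'C(r, j) = 'C(r, k.+1) by apply: bin_compl.
have Es2 : 'C(r, j.+1) = 'C(r, k) by apply: bin_compl; lia.
have kE f : f <= 'C(r, j) -> shadow_min r k.+1 ('C(r, j) - f) + ext_max r j f = 'C(r, k).
  by move=> Hf; rewrite Ek in Hf *; apply: shadow_min_ext_max.
have := subadd k.+1 ('C(r, j) - a) ('C(r, j) - b).
have := kE a; have := kE b; have := kE (a + b - 'C(r, j)).
have -> : 'C(r, j) - (a + b - 'C(r, j)) = 'C(r, j) - a + ('C(r, j) - b) by lia.
by rewrite Es2 -Es; lia.
Qed.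

(** Subadditivity follows the cascade of [c]: its leading term ['C(s, k.+1)] contributes at most
    ['C(s, k)] by induction, and the remainder already has the right form. The separate [s] shrinks
    along the cascade while subadditivity stays at [r]. *)
Lemma shadow_min_le_size r (subadd : shadow_subadditive r)
  k c : c <= 'C(r, k.+1) -> c <= 'C(r, k) -> shadow_min r k c <= shadow_min r k.+1 c.
Proof.
suff H s : s <= r -> forall c, c <= 'C(s, k.+1) -> c <= 'C(r, k) ->
    shadow_min r k c <= shadow_min s k.+1 c.
  exact: H.
elim: s => [|s IH] Hs {}c Hc Hck.
  by move: Hc; rewrite bin0n leqn0 => /eqP ->; rewrite shadow_min_m0.
case: (pascal_splitP Hc) => [H -> _|x Ec Hx Hx' -> _]; first by apply: IH; lia.
have := subadd k 'C(s, k.+1) x; rewrite -Ec => /(_ Hck).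
rewrite (@shadow_min_widen s r k x) ?(ltnW Hs) //.
have := IH (ltnW Hs) 'C(s, k.+1) (leqnn _).
have := @shadow_min_le s k 'C(s, k.+1) (leqnn _).
lia.
Qed.

Lemma ext_max_ge_size r (superadd : ext_superadditive r)
  j c : c <= 'C(r, j.+1) -> c <= 'C(r, j) -> ext_max r j.+1 c <= ext_max r j c.
Proof.
suff H s : s <= r -> forall c, c <= 'C(s, j.+1) -> c <= 'C(r, j) ->
    ext_max s j.+1 c <= ext_max r j c.
  exact: H.
elim: s => [|s IH] Hs {}c Hc Hck //.
case: (pascal_splitP Hc) => [H _ ->|x Ec Hx Hx' _ ->]; first by apply: IH; lia.
have := superadd j 'C(s, j.+1) x; rewrite -Ec => /(_ Hck).
have := @ext_max_mono_r s r j x (ltnW Hs) Hx'.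
have := IH (ltnW Hs) 'C(s, j.+1) (leqnn _).
rewrite ext_max_full.
lia.
Qed.

(** The two properties need each other. When [a] and [b] are small but [a + b] is not, the families
    overlap at level [r], and the bound there comes from the other function by duality. The
    remaining cases use additivity at [r] and comparison of consecutive set sizes. *)
Lemma shadow_ext_additive r : shadow_subadditive r /\ ext_superadditive r.
Proof.
elim: r => [|r [subadd superadd]].
  by split=> // -[|j] a b //; rewrite !ext_max_j0 !if_same.
have overK := shadow_overlap superadd; have overU := ext_overlap subadd.
have leK := shadow_min_le_size subadd; have geU := ext_max_ge_size superadd.
split=> [[|k] a b Hab|[|j] a b Hab].
- by rewrite !shadow_min_k0.
- wlog Hba : a b Hab / b <= a.
    move=> W; case: (leqP b a) => H; first exact: W.
    by rewrite addnC [X in _ <= X]addnC; apply: W; lia.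
  have [Ha Hb] : a <= 'C(r.+1, k.+1) /\ b <= 'C(r.+1, k.+1) by lia.
  case: (pascal_splitP Ha) => [Ha1 -> _|x Ea Hx Hx' -> _];
  case: (pascal_splitP Hb) => [Hb1 -> _|y Eb Hy Hy' -> _];
  case: (pascal_splitP Hab) => [Hab1 -> _|z Eab Hz Hz' -> _]; try lia.
  + exact: subadd.
  + have kr : k < r by rewrite -bin_gt0; lia.
    have := overK k a b kr Ha1 Hb1.
    have -> : a + b - 'C(r, k.+1) = z by lia.
    have := leK k z; lia.
  + have -> : z = x + b by lia.
    have := subadd k x b; have := leK k b; lia.
  + have -> : z = 'C(r, k.+1) + (x + y) by lia.
    have := subadd k 'C(r, k.+1) (x + y); have := subadd k x y.
    have := leK k 'C(r, k.+1); have := shadow_min_le (leqnn 'C(r, k.+1)); lia.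
- rewrite bin0 in Hab; rewrite !ext_max_j0.
  by case: (a =P 0); case: (b =P 0); case: (a + b =P 0); lia.
- wlog Hba : a b Hab / b <= a.
    move=> W; case: (leqP b a) => H; first exact: W.
    by rewrite addnC (addnC a); apply: W; lia.
  have [Ha Hb] : a <= 'C(r.+1, j.+1) /\ b <= 'C(r.+1, j.+1) by lia.
  case: (pascal_splitP Ha) => [Ha1 _ ->|x Ea Hx Hx' _ ->];
  case: (pascal_splitP Hb) => [Hb1 _ ->|y Eb Hy Hy' _ ->];
  case: (pascal_splitP Hab) => [Hab1 _ ->|z Eab Hz Hz' _ ->]; try lia.
  + exact: superadd.
  + have := overU j.+1 a b Ha1 Hb1.
    have -> : a + b - 'C(r, j.+1) = z by lia.
    have := geU j z; lia.
  + have -> : z = x + b by lia.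
    have := superadd j x b; have := geU j b; lia.
  + have -> : z = 'C(r, j.+1) + (x + y) by lia.
    have := superadd j 'C(r, j.+1) (x + y); have := superadd j x y.
    have := geU j 'C(r, j.+1); rewrite ext_max_full; lia.
Qed.

(** * The Eckhoff-Wegner inequality and its equality case *)

Lemma shadow_min_pascal r k a b : a <= 'C(r, k) -> b <= 'C(r, k.+1) ->
  shadow_min r.+1 k.+1 (a + b) <= shadow_min r k a + maxn a (shadow_min r k.+1 b).
Proof.
elim: r k a b => [|r IH] k a b Ha Hb.
  move: Hb; rewrite bin0n leqn0 => /eqP ->; rewrite addn0 shadow_min_m0 maxn0.
  case: k => [|k] in Ha *; last by move: Ha; rewrite bin0n leqn0 => /eqP ->; rewrite shadow_min_m0.
  rewrite bin0 in Ha; case: a Ha => [|[|a]] // _.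
have Hab : a + b <= 'C(r.+2, k.+1) by rewrite binS; lia.
case: k => [|k] in Ha Hb Hab *.
  have := shadow_min_le Hab; rewrite !shadow_min_k0 !bin0.
  case: (posnP a) => [->|]; last by lia.
  by rewrite add0n max0n shadow_min_small.
have [subadd superadd] := shadow_ext_additive r.
have overK := shadow_overlap superadd.
have E1 := binS r k; have E2 := binS r k.+1.
(* When the three splittings agree, the induction hypothesis applies. A carry with [a] small is
   absorbed by [subadd] or [overK]; with only [a] big, the term [a] in the maximum exceeds
   ['C(r, k.+1)]. *)
case: (pascal_splitP Hab) => [Hab1 ->|c Eab Hc Hc' ->] _;
  case: (pascal_splitP Ha) => [Ha1 -> _|x Ea Hx Hx' -> _];
  case: (pascal_splitP Hb) => [Hb1 -> _|y Eb Hy Hy' -> _]; try lia.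
- exact: IH.
- rewrite (shadow_min_big (x := a + y)); [|lia|lia].
  by have := subadd k.+1 a y; lia.
- by have := shadow_min_le Hab1; lia.
- rewrite (shadow_min_small (k := k.+1)); last by lia.
  have -> : c = a + y - 'C(r, k.+1) by lia.
  have kr : k < r by rewrite -bin_gt0; lia.
  by have := overK k a y kr; lia.
(* Since [b] fits below its threshold, [c <= x]. The instance at 0 bounds the shadow of [x] by
   [shadow_min r k x + x], and this [x] is the part of [a] above ['C(r, k.+1)]. *)
- have := IH k x 0; rewrite addn0 shadow_min_m0 maxn0.
  have: shadow_min r.+1 k.+1 c <= shadow_min r.+1 k.+1 x by apply: shadow_min_mono; lia.
  by lia.
- have -> : c = x + y by lia.
  by have := IH k x y; lia.
Qed.

(** If [b] has cascade terms ['C(n_i, i)], its shadow has terms ['C(n_i, i - 1)], so by Pascal's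
    rule their sum has terms ['C(n_i + 1, i)]; Pascal's rule then splits the shadow of that sum. The
    induction peels off one term at a time. *)
Lemma shadow_min_pascal_eq r k b : b <= 'C(r, k.+1) ->
  shadow_min r k.+1 b + shadow_min r k (shadow_min r k.+1 b) <=
  shadow_min r.+1 k.+1 (shadow_min r k.+1 b + b).
Proof.
elim: r k b => [|r IH] k b Hb; first by [].
case: k => [|k] in Hb *.
  rewrite shadow_min_k0 addn0; case: (posnP b) => [->|b0]; first by rewrite shadow_min_m0.
  have := shadow_min_le Hb; rewrite bin0; case: (shadow_min _ _ _) => [|[|//]] // _.
  have Hb1 : 1 + b <= 'C(r.+2, 1) by rewrite !bin1 in Hb *; lia.
  have := shadow_min_mono (k := 1) (leq_addr b 1) Hb1.
  by rewrite (shadow_min_widen (r := 1)).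
have Hk := shadow_min_le Hb.
have E1 := binS r k; have E2 := binS r k.+1.
case: (pascal_splitP Hb) => [Hb1 E _|y Eb Hy Hy' E _].
  have Hk1 := shadow_min_le Hb1.
  have Hs : shadow_min r k.+2 b + b <= 'C(r.+1, k.+2) by lia.
  rewrite E (shadow_min_small Hk1) (shadow_min_small Hs).
  exact: IH.
rewrite E (@shadow_min_big r.+1 k.+1 _ (shadow_min r k.+1 y + y)); [|lia|lia].
case: (posnP (shadow_min r k.+1 y)) => [->|k0].
  have kr : k < r by rewrite -bin_gt0; lia.
  by rewrite addn0 (@shadow_min_small r k.+1 'C(r, k.+1)) // shadow_min_full // E1 leq_addr.
rewrite (@shadow_min_big r k _ (shadow_min r k.+1 y)) //.
by have := IH k y Hy'; lia.
Qed.

(** * Kruskal-Katona for subspaces *)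

Section Monomials.
Variables (k : fieldType) (n : nat).
Implicit Types (f : Rsq k n) (A B Y : {set 'I_n}) (M : {set {set 'I_n}}).
Implicit Types (W : {vspace Rsq k n}) (j x : 'I_n).
Local Open Scope ring_scope.

(** * Multiplication by a variable and its derivation *)

Fact mulx_fun_is_linear j : linear (@mulx_fun k n j).
Proof.
move=> c f g; apply/ffunP=> A; rewrite !ffunE.
by case: ifP; rewrite // scaler0 addr0.
Qed.

HB.instance Definition _ j :=
  GRing.isLinear.Build k (Rsq k n) (Rsq k n) _ (@mulx_fun k n j) (mulx_fun_is_linear j).

Lemma mulxE j f A : mulx k j f A = if j \in A then f (A :\ j) else 0.
Proof. by rewrite lfunE /= ffunE. Qed.

(** Writing [f = g + x_j h] with [g] and [h] free of [x_j], this is [h]; its kernel consists of the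
    elements free of [x_j]. *)
Definition delx_fun j f : Rsq k n :=
  [ffun A : {set 'I_n} => if j \in A then 0 else f (j |: A)].

Fact delx_fun_is_linear j : linear (delx_fun j).
Proof.
move=> c f g; apply/ffunP=> A; rewrite !ffunE.
by case: ifP; rewrite // scaler0 addr0.
Qed.

HB.instance Definition _ j :=
  GRing.isLinear.Build k (Rsq k n) (Rsq k n) _ (delx_fun j) (delx_fun_is_linear j).

Definition delx j : 'End(Rsq k n) := linfun (delx_fun j).

Lemma delxE j f A : delx j f A = if j \in A then 0 else f (j |: A).
Proof. by rewrite lfunE /= ffunE. Qed.

Lemma delx_mulx_same x f : delx x f = 0 -> delx x (mulx k x f) = f.
Proof.
move=> Hf; apply/ffunP=> A; rewrite delxE; case: ifP => HA.
  move/ffunP: Hf => /(_ (A :\ x)); rewrite delxE !inE eqxx /= ffunE.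
  by rewrite setD1K.
by rewrite mulxE setU11 setU1K // HA.
Qed.

Lemma delx_mulx_neq x j f : j != x -> delx x (mulx k j f) = mulx k j (delx x f).
Proof.
move=> jx; apply/ffunP=> A; rewrite !(delxE, mulxE) !inE (negPf jx) eq_sym (negPf jx) /=.
case: ifP => xA; first by rewrite if_same.
case: ifP => // jA; congr (f _); apply/setP=> y; rewrite !inE.
by case: (y =P x) => [->|] //=; rewrite eq_sym jx.
Qed.

Lemma mulxC i j f : mulx k i (mulx k j f) = mulx k j (mulx k i f).
Proof.
apply/ffunP=> A; rewrite !mulxE !inE (eq_sym j i).
case: (eqVneq i j) => [->|ij] //=.
by case: ifP; case: ifP => // _ _; rewrite setDDl setUC -setDDl.
Qed.

Lemma mulx2 j f : mulx k j (mulx k j f) = 0.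
Proof. by apply/ffunP=> A; rewrite !mulxE !inE eqxx /= ffunE if_same. Qed.

Lemma mspanP M f : reflect (forall A, A \notin M -> f A = 0) (f \in mspan k M).
Proof.
apply: (iffP idP) => [|Hf].
  rewrite /mspan -[X in <<X>>%VS]in_tupleE => /coord_span -> A HA.
  rewrite sum_ffunE big1 // => i _; rewrite !ffunE.
  have: (in_tuple [seq mono k B | B <- enum M])`_i \in [seq mono k B | B <- enum M].
    by rewrite mem_nth // size_tuple.
  case/mapP=> B; rewrite mem_enum => HB ->; rewrite ffunE.
  by case: eqP => [AB|_]; rewrite ?scaler0 //; move: HA; rewrite AB HB.
have -> : f = \sum_(A in M) f A *: mono k A.
  apply/ffunP=> B; rewrite sum_ffunE.
  case: (boolP (B \in M)) => HB.
    rewrite (bigD1 B) //= !ffunE eqxx big1 ?addr0 => [|A /andP[_ AB]].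
      by rewrite /GRing.scale /= mulr1.
    by rewrite !ffunE eq_sym (negPf AB) scaler0.
  rewrite Hf // big1 // => A HA; rewrite !ffunE.
  by case: eqP => [AB|_]; rewrite ?scaler0 //; move: HB; rewrite AB HA.
by apply: memv_suml => A HA; apply/memvZ/memv_span/map_f; rewrite mem_enum.
Qed.

Lemma dim_mspan M : \dim (mspan k M) = #|M|.
Proof.
rewrite cardE -(size_map (@mono k n)); apply/eqP.
rewrite -/(free _) -[X in free X]in_tupleE; apply/freeP => c Hc i.
have Hi : (i < size (enum M))%N by rewrite -(size_map (@mono k n)).
move/ffunP: Hc => /(_ (nth set0 (enum M) i)); rewrite sum_ffunE ffunE.
have E (l : 'I_(size [seq mono k A | A <- enum M])) :
    ([seq mono k A | A <- enum M]`_l) = mono k (nth set0 (enum M) l).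
  by rewrite (nth_map set0) // -(size_map (@mono k n)).
rewrite (bigD1 i) //= !ffunE E ffunE eqxx big1 => [|l li].
  by rewrite addr0 /GRing.scale /= mulr1.
rewrite !ffunE E ffunE nth_uniq ?enum_uniq -?(size_map (@mono k n) (enum M)) //.
by rewrite eq_sym val_eqE (negPf li) scaler0.
Qed.

(** Covers both [m1] (all variables) and [n1 i] (all but [i]), and lets the induction on variables
    stay inside one ambient space. *)
Definition mulY Y W : {vspace Rsq k n} := (\sum_(j in Y) (mulx k j @: W))%VS.

Lemma mulx_mulY Y W j f : j \in Y -> f \in W -> mulx k j f \in mulY Y W.
Proof.
move=> jY fW; apply: (subvP (sumv_sup j jY (subvv _))).
exact: memv_img.
Qed.

Lemma mulY_subP Y W (U : {vspace Rsq k n}) :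
  (forall j f, j \in Y -> f \in W -> mulx k j f \in U) -> (mulY Y W <= U)%VS.
Proof.
move=> H; apply/subv_sumP=> j jY; apply/subvP=> _ /memv_imgP[f fW ->].
exact: H.
Qed.

Definition degset Y d : {set {set 'I_n}} := [set A : {set 'I_n} | A \subset Y & #|A| == d].

Lemma dim_degset_le Y d W : (W <= mspan k (degset Y d))%VS -> (\dim W <= 'C(#|Y|, d))%N.
Proof. by move=> /dimvS; rewrite dim_mspan cards_draws. Qed.

Lemma degset_U1 x Y d A : x \notin A -> A \in degset (x |: Y) d -> A \in degset Y d.
Proof.
rewrite !inE => xA /andP[AY ->]; rewrite andbT; apply/subsetP=> y yA.
have := subsetP AY _ yA; rewrite !inE; case: eqP => // E.
by move: xA; rewrite -E yA.
Qed.

Lemma degset_D1 x Y d A : x \notin A -> x |: A \in degset (x |: Y) d.+1 -> A \in degset Y d.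
Proof.
move=> xA H; apply: (degset_U1 xA); move: H.
by rewrite !inE cardsU1 xA eqSS subUset => /andP[/andP[_ ->] ->].
Qed.

Lemma delx_ker_degset x Y d W : (W <= mspan k (degset (x |: Y) d))%VS ->
  (W :&: lker (delx x) <= mspan k (degset Y d))%VS.
Proof.
move=> HW; apply/subvP=> f /memv_capP[/(subvP HW)/mspanP Hf].
rewrite memv_ker => /eqP/ffunP Hx; apply/mspanP=> A HA.
case: (boolP (x \in A)) => xA.
  by have := Hx (A :\ x); rewrite delxE !inE eqxx /= ffunE setD1K.
by apply: Hf; apply: contra HA; apply: degset_U1.
Qed.

Lemma delx_img_degset x Y d W : (W <= mspan k (degset (x |: Y) d.+1))%VS ->
  (delx x @: W <= mspan k (degset Y d))%VS.
Proof.
move=> HW; apply/subvP=> _ /memv_imgP[f /(subvP HW)/mspanP Hf ->].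
apply/mspanP=> A HA; rewrite delxE; case: ifP => // /negbT xA.
by apply: Hf; apply: contra HA; apply: degset_D1.
Qed.

Lemma delx_img_degset0 x Y W : (W <= mspan k (degset Y 0%N))%VS -> (delx x @: W)%VS = 0%VS.
Proof.
move=> HW; apply/eqP; rewrite -subv0; apply/subvP=> _ /memv_imgP[f /(subvP HW)/mspanP Hf ->].
rewrite memv0; apply/eqP/ffunP=> A; rewrite delxE ffunE; case: ifP => // xA.
by apply: Hf; rewrite !inE cardsU1 xA andbF.
Qed.

(** The size [#|Y| - d] is that of the complement in [Y] of a degree [d] support; multiplying by a
    variable removes a point from it. *)
Lemma dim_mulY_ge Y d W : (W <= mspan k (degset Y d))%VS ->
  (shadow_min #|Y| (#|Y| - d) (\dim W) <= \dim (mulY Y W))%N.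
Proof.
move Er: #|Y| => r; elim: r Y Er d W => [|r IH] Y Er d W HW //.
have /card_gt0P[x xY] : (0 < #|Y|)%N by rewrite Er.
have [Y' [xY' EY]] : exists Y', x \notin Y' /\ Y = x |: Y'.
  by exists (Y :\ x); rewrite setD11 setD1K.
have Er' : #|Y'| = r by move: Er; rewrite EY cardsU1 xY' => -[].
subst Y.
case: (leqP d r) => dr; last first.
  by have -> : (r.+1 - d = 0)%N by lia.
rewrite subSn //.
have H0 := delx_ker_degset HW.
set W0 := (W :&: _)%VS in H0; pose W1 := (delx x @: W)%VS.
have EW : (\dim W = \dim W0 + \dim W1)%N by rewrite -(limg_ker_dim (delx x) W).
pose Z := mulY (x |: Y') W.
have jx j : j \in Y' -> j != x by move=> jY; apply: contraNneq xY' => <-.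
have EZ : (\dim Z = \dim (Z :&: lker (delx x)) + \dim (delx x @: Z))%N.
  by rewrite -(limg_ker_dim (delx x) Z).
have Z0 : (mulY Y' W0 <= Z :&: lker (delx x))%VS.
  apply: mulY_subP => j f jY /memv_capP[fW]; rewrite memv_ker => /eqP Hf.
  apply/memv_capP; split; first by apply: mulx_mulY; rewrite // !inE jY orbT.
  by rewrite memv_ker delx_mulx_neq ?jx // Hf linear0.
have Z1 : (mulY Y' W1 <= delx x @: Z)%VS.
  apply: mulY_subP => j _ jY /memv_imgP[f fW ->].
  rewrite -delx_mulx_neq ?jx //; apply: memv_img.
  by apply: mulx_mulY; rewrite // !inE jY orbT.
(* An element of [W0] is free of [x], so it is recovered from its multiple by [x]. Thus the image of
   [Z] contains both [W0] and the multiples of [W1], whence the maximum. *)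
have Z2 : (W0 <= delx x @: Z)%VS.
  apply/subvP=> f /memv_capP[fW]; rewrite memv_ker => /eqP Hf.
  rewrite -(delx_mulx_same Hf); apply/memv_img/mulx_mulY; rewrite ?setU11 //.
have := IH _ Er' _ _ H0.
have := dimvS Z0; have := dimvS Z1; have := dimvS Z2.
have := dim_degset_le H0; rewrite Er' (@bin_compl r d (r - d)); last by lia.
move=> D0 S2 S1 S0 IH0.
have [D1 IH1] : (\dim W1 <= 'C(r, (r - d).+1) /\
    shadow_min r (r - d).+1 (\dim W1) <= \dim (mulY Y' W1))%N.
  (* In degree 0 there is no degree below for [W1] to live in, but then [W1] vanishes. *)
  case: d => [|d] in HW {H0 Z0 Z1 Z2} dr D0 IH0 *.
    by rewrite /W1 (delx_img_degset0 _ HW) dimv0 shadow_min_m0.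
  have H1 := delx_img_degset HW.
  have := IH _ Er' _ _ H1; have := dim_degset_le H1.
  rewrite Er' -/W1 subnSK // (@bin_compl r d (r - d)); last by lia.
  by split.
have := shadow_min_pascal D0 D1.
rewrite -EW -/Z EZ => /leq_trans; apply; apply: leq_add (leq_trans IH0 S0) _.
by rewrite geq_max S2 (leq_trans IH1 S1).
Qed.

(** * Upper shadows and families attaining the bound *)

Definition shadow Y M : {set {set 'I_n}} :=
  [set p.1 |: p.2 | p in setX Y M & p.1 \notin p.2].

Lemma mem_shadow Y M j A : j \in Y -> A \in M -> j \notin A -> j |: A \in shadow Y M.
Proof. by move=> jY AM jA; apply/imsetP; exists (j, A) => //; rewrite !inE jY AM. Qed.

Lemma shadowP Y M B :
  reflect (exists j A, [/\ j \in Y, A \in M, j \notin A & B = j |: A]) (B \in shadow Y M).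
Proof.
apply: (iffP imsetP) => [[[j A]]|[j [A [jY AM jA ->]]]].
  by rewrite !inE => /andP[/andP[/= jY AM] jA] ->; exists j, A.
by exists (j, A) => //; rewrite !inE jY AM.
Qed.

Lemma mulY_mspan Y M : (mulY Y (mspan k M) <= mspan k (shadow Y M))%VS.
Proof.
apply: mulY_subP => j f jY /mspanP Hf; apply/mspanP=> B HB; rewrite mulxE.
case: ifP => // jB; apply: Hf; apply: contra HB => HB.
by rewrite -(setD1K jB); apply: mem_shadow; rewrite // setD11.
Qed.

Lemma shadow_degset Y d M : M \subset degset Y d -> shadow Y M \subset degset Y d.+1.
Proof.
move=> /subsetP sM; apply/subsetP=> _ /shadowP[j [A [jY /sM + jA ->]]].
rewrite !inE => /andP[AY /eqP cA].
by rewrite cardsU1 jA cA eqxx andbT subUset sub1set jY.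
Qed.

Lemma shadow_cone x Y M1 M2 :
  shadow (x |: Y) ([set x |: A | A in M1] :|: M2) \subset
  [set x |: A | A in shadow Y M1 :|: M2] :|: shadow Y M2.
Proof.
apply/subsetP=> _ /shadowP[j [B [jY BM jB ->]]]; rewrite inE.
case/setUP: BM => [/imsetP[A AM EB]|BM].
  move: jB jY; rewrite EB !inE negb_or => /andP[jx jA]; rewrite (negPf jx) /= => jY.
  apply/orP; left; apply/imsetP; exists (j |: A); last by rewrite setUCA.
  by rewrite inE mem_shadow.
case/setU1P: jY => [->|jY]; last by rewrite mem_shadow ?orbT.
by apply/orP; left; apply/imsetP; exists B => //; rewrite inE BM orbT.
Qed.

Lemma card_cone x Y M : x \notin Y -> (forall A, A \in M -> A \subset Y) ->
  #|[set x |: A | A in M]| = #|M|.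
Proof.
move=> xY sM; apply: card_in_imset => A B /sM sA /sM sB E.
have Yx (C : {set 'I_n}) : C \subset Y -> x \notin C.
  by move=> sC; apply: contra xY; apply: (subsetP sC).
by rewrite -(setU1K (Yx _ sA)) E setU1K ?Yx.
Qed.

(** Put [x] in as many members as possible, since multiplying these by [x] gives 0. Up to ['C(r, d)]
    members, take a cone over an optimal family; beyond that, take every set containing [x] and an
    optimal family avoiding it. *)
Lemma shadow_min_attained Y d m : (m <= 'C(#|Y|, d))%N ->
  exists M : {set {set 'I_n}}, [/\ M \subset degset Y d, #|M| = m &
    (#|shadow Y M| <= shadow_min #|Y| (#|Y| - d) m)%N].
Proof.
have shadow0 Z : shadow Z set0 = set0.
  by apply/setP=> B; rewrite inE; apply/shadowP=> -[j [A []]]; rewrite inE.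
move Er: #|Y| => r; elim: r Y Er d m => [|r IH] Y Er d m Hm;
  case: (posnP m) => [->|m0]; try by exists set0; rewrite shadow0 sub0set !cards0.
  have Y0 : Y = set0 by apply: cards0_eq.
  move: Hm; rewrite bin0n; case: d => [|d]; case: m m0 => [|[|m]] // _ _.
  exists [set set0]; split; rewrite ?cards1 // ?sub1set ?inE ?sub0set ?cards0 //.
  rewrite leqn0 cards_eq0 -subset0; apply/subsetP=> B /shadowP[j [A []]].
  by rewrite Y0 inE.
case: d => [|d] in Hm *.
  have -> : m = 1%N by move: Hm; rewrite bin0; lia.
  exists [set set0]; split; rewrite ?cards1 // ?sub1set ?inE ?sub0set ?cards0 //.
  (* The count 1 is read as ['C(r.+1, r.+1)]; the shadow of the empty set consists of the singletons
     of [Y]. *)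
  rewrite subn0 -(binn r.+1) shadow_min_full // binSn -Er.
  have/subset_leq_card/leq_trans-> // : shadow Y [set set0] \subset [set [set y] | y in Y].
    apply/subsetP=> _ /shadowP[j [A [jY /set1P-> _ ->]]].
    by rewrite setU0; apply: imset_f.
  exact: leq_imset_card.
have /card_gt0P[x xY] : (0 < #|Y|)%N by rewrite Er.
have [Y' [xY' EY]] : exists Y', x \notin Y' /\ Y = x |: Y'.
  by exists (Y :\ x); rewrite setD11 setD1K.
have Er' : #|Y'| = r by move: Er; rewrite EY cardsU1 xY' => -[].
subst Y; rewrite subSS.
have sY e M A : M \subset degset Y' e -> A \in M -> A \subset Y' /\ #|A| = e.
  by move=> /subsetP s /s; rewrite inE => /andP[sA /eqP].
have xA A : A \subset Y' -> x \notin A by move=> sA; apply: contra xY'; apply: (subsetP sA).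
have sub M1 M2 : M1 \subset degset Y' d -> M2 \subset degset Y' d.+1 ->
    [set x |: A | A in M1] :|: M2 \subset degset (x |: Y') d.+1 /\
    #|[set x |: A | A in M1] :|: M2| = (#|M1| + #|M2|)%N.
  move=> s1 s2; split.
    rewrite subUset; apply/andP; split; apply/subsetP.
      move=> _ /imsetP[A /(sY _ _ _ s1)[sA cA] ->].
      by rewrite inE cardsU1 (xA _ sA) cA eqxx andbT setUS.
    move=> A /(sY _ _ _ s2)[sA cA].
    by rewrite inE cA eqxx andbT (subset_trans sA) ?subsetUr.
  rewrite cardsU (card_cone xY') => [|A /(sY _ _ _ s1)[]//].
  rewrite [X in (_ - X)%N](_ : _ = 0%N) ?subn0 //; apply/eqP; rewrite cards_eq0 -subset0.
  apply/subsetP=> _ /setIP[/imsetP[A _ ->] /(sY _ _ _ s2)[/xA]].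
  by rewrite setU11.
case: (leqP m 'C(r, d)) => Hmd.
  have := IH Y' Er' d m Hmd; case=> M1 [s1 c1 sh1].
  have [s c] := sub M1 set0 s1 (sub0set _).
  exists ([set x |: A | A in M1] :|: set0); split; rewrite // ?c ?cards0 ?addn0 //.
  apply: leq_trans (subset_leq_card (shadow_cone _ _ _ _)) _.
  rewrite shadow0 !setU0; apply: leq_trans (leq_imset_card _ _) _.
  apply: leq_trans sh1 _; case: (leqP d r) => dr.
    by rewrite shadow_min_small // (@bin_compl r _ d) //; lia.
  by have -> : (r - d = 0)%N by [lia]; rewrite !shadow_min_k0.
rewrite binS in Hm.
have dr : (d < r)%N by rewrite -bin_gt0; lia.
have Hm2 : (m - 'C(r, d) <= 'C(r, d.+1))%N by lia.
have [M2 [s2 c2 sh2]] := IH Y' Er' d.+1 _ Hm2.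
have [s c] := sub (degset Y' d) M2 (subxx _) s2.
exists ([set x |: A | A in degset Y' d] :|: M2); split=> //.
  by rewrite c cards_draws Er' c2; lia.
apply: leq_trans (subset_leq_card (shadow_cone _ _ _ _)) _.
rewrite -[(r - d)%N]subnSK // (@shadow_min_big r _ m (m - 'C(r, d))); last by lia.
  rewrite (@bin_compl r (r - d.+1) d.+1); last by lia.
  (* The members containing [x] come from [degset Y' d.+1], which has ['C(r, d.+1)] elements; those
     avoiding [x] come from the shadow of [M2]. *)
  apply: leq_trans (leq_card_setU _ _) (leq_add _ sh2).
  apply: leq_trans (leq_imset_card _ _) _.
  rewrite -Er' -cards_draws; apply: subset_leq_card.
  by rewrite subUset s2 shadow_degset.
by rewrite subnSK // (@bin_compl r (r - d) d); lia.
Qed.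

Lemma dim_mulY_attained Y d m : (m <= 'C(#|Y|, d))%N ->
  exists2 W : {vspace Rsq k n}, (W <= mspan k (degset Y d))%VS & \dim W = m /\
    (\dim (mulY Y W) <= shadow_min #|Y| (#|Y| - d) m)%N.
Proof.
move=> /shadow_min_attained[M [sM cM shM]]; exists (mspan k M).
  apply/subvP=> f /mspanP Hf; apply/mspanP=> A HA; apply: Hf.
  by apply: contra HA; apply: (subsetP sM).
split; first by rewrite dim_mspan.
by apply: leq_trans (dimvS (mulY_mspan _ _)) _; rewrite dim_mspan.
Qed.

End Monomials.

(** * Comparing the direct sum with the bound *)

Theorem theorem4p10 (k : fieldType) (n : nat) (i : 'I_n) (d : nat)
    (V0 V1 : {vspace Rsq k n}) :
  (1 <= d)%N ->
  monomial_space V0 -> monomial_space V1 ->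
  GotzmannQ i d V0 -> GotzmannQ i d.-1 V1 ->
  V0 = n1 i V1 ->
  GotzmannR d (V0 + (mulx k i @: V1))%VS.
Proof.
case: d => // d _ _ _ /= gV0 gV1 EV0.
pose Y := [set~ i].
have EY : setT = i |: Y by apply/setP=> y; rewrite !inE orbN.
have iY : i \notin Y by rewrite !inE eqxx.
have EQ e : Qdeg k i e = mspan k (degset Y e).
  rewrite /Qdeg; congr (mspan k _); apply/setP=> A.
  by rewrite !inE andbC subsetC sub1set !inE.
have ER e : Rdeg k n e = mspan k (degset setT e).
  by rewrite /Rdeg; congr (mspan k _); apply/setP=> A; rewrite !inE subsetT.
have En1 (W : {vspace Rsq k n}) : n1 i W = mulY Y W by apply: eq_bigl => j; rewrite !inE.
have Em1 (W : {vspace Rsq k n}) : m1 W = mulY setT W by apply: eq_bigl => j; rewrite inE.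
move Er: #|Y| => r; have ErT : #|[set: 'I_n]| = r.+1 by rewrite EY cardsU1 iY Er.
(* A Gotzmann space does at least as well as the optimal space of its dimension, so it meets the
   lower bound exactly. *)
have best e (V : {vspace Rsq k n}) : GotzmannQ i e V ->
    \dim (n1 i V) = shadow_min r (r - e) (\dim V).
  case; rewrite EQ => sV gV; apply/eqP; rewrite eqn_leq -Er En1 dim_mulY_ge // andbT.
  have [W sW [dW shW]] := dim_mulY_attained k (dim_degset_le sV).
  by apply: leq_trans shW; rewrite -!En1 gV.
have E0 := best _ _ gV0; have E1 := best _ _ gV1; rewrite -EV0 in E1.
have [sV0 _] := gV0; have [sV1 _] := gV1; rewrite !EQ in sV0 sV1.
have D0 := dim_degset_le sV0; have D1 := dim_degset_le sV1; rewrite Er in D0 D1.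
(* The derivation kills [V0] and undoes multiplication by [x_i] on [V1]; this makes that
   multiplication injective on [V1] and the sum direct. *)
have Vi (f : Rsq k n) e : f \in mspan k (degset Y e) -> delx k i f = 0%R.
  move=> /mspanP Hf; apply/ffunP=> A; rewrite delxE ffunE; case: ifP => // _.
  by apply: Hf; rewrite inE negb_and; apply/orP; left; apply/subsetPn; exists i; rewrite ?setU11.
have mulK (f : Rsq k n) e : f \in mspan k (degset Y e) -> delx k i (mulx k i f) = f.
  by move=> Hf; apply/delx_mulx_same/Vi/Hf.
have dim_img : \dim (mulx k i @: V1) = \dim V1.
  apply: limg_dim_eq; apply/eqP; rewrite -subv0; apply/subvP=> f /memv_capP[fV].
  rewrite memv_ker => /eqP Hf; rewrite memv0 -(mulK f d) ?Hf ?linear0 //.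
  exact: (subvP sV1).
have dimV : \dim (V0 + mulx k i @: V1) = (\dim V0 + \dim V1)%N.
  rewrite -dim_img; apply: dimv_disjoint_sum; apply/eqP; rewrite -subv0.
  apply/subvP=> f /memv_capP[fV /memv_imgP[g gV Ef]]; rewrite memv0.
  move: fV; rewrite Ef => /(subvP sV0)/Vi.
  by rewrite (mulK g d) ?(subvP sV1) // => ->; rewrite linear0.
split.
  rewrite ER subv_add; apply/andP; split; apply/subvP.
    move=> f /(subvP sV0)/mspanP Hf; apply/mspanP=> A HA; apply: Hf.
    by apply: contra HA; rewrite !inE subsetT => /andP[].
  move=> _ /memv_imgP[f /(subvP sV1)/mspanP Hf ->]; apply/mspanP=> A HA.
  rewrite mulxE; case: ifP => // iA; apply: Hf; apply: contra HA.
  by rewrite !inE subsetT /= (cardsD1 i A) iA => /andP[_ /eqP->].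
move=> W; rewrite ER => sW dW; rewrite !Em1.
have HW := dim_mulY_ge sW; rewrite ErT subSS dW dimV in HW.
apply: leq_trans HW.
(* Here [x_i] kills [x_i V1], while [x_j x_i V1] lies in [x_i V0] for [j != i], because
   [V0 = n1 i V1]. *)
have sV : (mulY setT (V0 + mulx k i @: V1) <= mulY Y V0 + mulx k i @: V0)%VS.
  apply: mulY_subP => j _ _ /memv_addP[f fV [_ /memv_imgP[g gV ->] ->]].
  rewrite linearD /=; case: (eqVneq j i) => [->|ji].
    by rewrite mulx2 addr0 (subvP (addvSr _ _)) // memv_img.
  have jY : j \in Y by rewrite !inE.
  apply: memv_add; first exact: mulx_mulY.
  by rewrite mulxC memv_img // EV0 En1 mulx_mulY.
apply: leq_trans (dimvS sV) (leq_trans (dimv_add_leqif _ _) _).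
have Himg : \dim (mulx k i @: V0) <= \dim V0.
  by rewrite -(limg_ker_dim (mulx k i) V0) leq_addl.
rewrite -En1 E0 addnC; apply: leq_trans (leq_add Himg (leqnn _)) _.
case: (ltnP d r) => dr; last first.
  have -> : \dim V0 = 0 by move: D0; rewrite bin_small //; lia.
  by rewrite shadow_min_m0.
(* By [E1] the shadow value of [\dim V1] is [\dim V0], so the equality case applies to
   [\dim V0 + \dim V1]. *)
have := @shadow_min_pascal_eq r (r - d.+1) (\dim V1).
rewrite subnSK // -E1 (@bin_compl r (r - d) d); last by lia.
by move=> /(_ D1); lia.
Qed.
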